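(* Let $p$ be a prime, let $A$ be a countable (countably infinite) elementary abelian $p$-group, and let $R={\rm End}(A)$. Then the finite topology $\mathcal T_{fin}$ is the only second metrizable (i.e. metrizable and second countable) ring topology $\mathcal T$ on $R$ for which $(R,\mathcal T)$ is complete.
   Context: An abelian group $A$ is an elementary abelian $p$-group if $pa=0$ for all $a\in A$. ${\rm End}(A)$ is the ring of all additive endomorphisms of $A$ under pointwise addition and composition. For $K\subseteq A$ put $T(K)=\{\alpha\in {\rm End}(A) : \alpha(K)=0\}$; the finite topology $\mathcal T_{fin}$ is the ring topology on ${\rm End}(A)$ for which the sets $T(K)$, with $K$ ranging over all finite subsets of $A$, form a fundamental system of neighborhoods of zero. A ring topology on a ring is a topology for which addition, negation and multiplication are (jointly) continuous; all topologies considered are assumed completely regular, in particular Hausdorff. A topological ring is metrizable if its additive group satisfies the first axiom of countability. Completeness refers to the uniform structure of the additive topological group. *)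

(* Defs.v *)
From HB Require Import structures.
From mathcomp Require Import all_boot all_order all_algebra.
From mathcomp Require Import all_classical all_reals all_analysis.

Set Implicit Arguments.
Unset Strict Implicit.
Unset Printing Implicit Defensive.

Import GRing.Theory.
Local Open Scope classical_set_scope.
Local Open Scope ring_scope.

(* A topology on a fixed carrier as a first-class value, so that one can
   quantify over all topologies on a ring; [topologized tau] is the carrier equipped
   with the topology [tau] as a [topologicalType]. *)
Record topology_on (T : Type) := Topology {
  opens : set_system T;
  opens_setT : opens setT;
  opens_setI : setI_closed opens;
  opens_bigcup : forall F : set_system T,
    F `<=` opens -> opens (\bigcup_(U in F) U)
}.

Definition topologized (T : Type) (tau : topology_on T) : Type := T.

Section Space.
Variables (T : choiceType) (tau : topology_on T).

HB.instance Definition _ := Choice.on (topologized tau).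

Let opens_bigcup_fun (I : Type) (f : I -> set (topologized tau)) :
  (forall i, opens tau (f i)) -> opens tau (\bigcup_i f i).
Proof.
move=> fo; have -> : \bigcup_i f i = \bigcup_(U in range f) U.
  by rewrite bigcup_image.
by apply: opens_bigcup => _ [i _ <-].
Qed.

HB.instance Definition _ := isOpenTopological.Build (topologized tau)
  (@opens_setT _ tau) (@opens_setI _ tau) opens_bigcup_fun.

Lemma open_topologizedE : @open (topologized tau) = opens tau.
Proof.
apply/seteqP; split => [U|U oU]; rewrite openE.
  move=> Uo; have -> : U = \bigcup_(V in [set V | opens tau V /\ V `<=` U]) V.
    apply/seteqP; split => [x /Uo [V [oV Vx VU]]|x [V [_ VU] /VU]//].
    by exists V.
  by apply: opens_bigcup => V [].
by move=> x Ux; exists U; split => //; exact: subset_refl.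
Qed.

End Space.

#[short(type="preTopologicalPzRingType")]
HB.structure Definition PreTopologicalPzRing :=
  {R of Topological R & GRing.PzRing R}.

HB.instance Definition _ (R : pzRingType) (tau : topology_on R) :=
  GRing.PzRing.on (topologized tau).

Definition first_countable (T : topologicalType) :=
  forall x : T, exists B : set_system T,
    [/\ countable B, B `<=` nbhs x & filter_from B id --> x].

Section TopologicalRings.
Variable X : preTopologicalPzRingType.

(* Ring topologies are required to be Tychonoff (the last two conjuncts). *)
Definition ring_topology :=
  [/\ continuous (fun x : X * X => x.1 + x.2),
      continuous (-%R : X -> X),
      continuous (fun x : X * X => x.1 * x.2),
      completely_regular_space X &
      hausdorff_space X].

(* For a topological group, metrizability amounts to first countability. *)
Definition metrizable_ring := first_countable X.

Definition second_metrizable := metrizable_ring /\ @second_countable X.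

Definition add_entourage : set_system (X * X) :=
  filter_from (nbhs (0 : X)) (fun U => [set xy | U (xy.1 - xy.2)]).

(* [(F, F) --> add_entourage] is [cauchy F] for the uniform structure of the
   additive group. *)
Definition add_complete :=
  forall F : set_system X, ProperFilter F ->
    (F, F) --> add_entourage -> exists x : X, F --> x.

End TopologicalRings.

Arguments ring_topology : clear implicits.
Arguments metrizable_ring : clear implicits.
Arguments second_metrizable : clear implicits.
Arguments add_complete : clear implicits.

Section Endomorphisms.
Variable A : zmodType.

Definition endo : Type := {additive A -> A}.
Implicit Types f g h : endo.

HB.instance Definition _ := gen_eqMixin endo.
HB.instance Definition _ := gen_choiceMixin endo.

Lemma endoP f g : f =1 g -> f = g.
Proof.
move: f g => [f [[fP]]] [g [[gP]]] /= /funext fg; subst g.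
by rewrite (Prop_irrelevance fP gP).
Qed.

Let zero : endo := \0.
Let add f g : endo := f \+ g.
Let opp f : endo := \- f.
Let one : endo := idfun.
Let mul f g : endo := f \o g.

Let addA : associative add.
Proof. by move=> f g h; apply: endoP => a /=; rewrite addrA. Qed.

Let addC : commutative add.
Proof. by move=> f g; apply: endoP => a /=; rewrite addrC. Qed.

Let add0 : left_id zero add.
Proof. by move=> f; apply: endoP => a /=; rewrite add0r. Qed.

Let addN : left_inverse zero opp add.
Proof. by move=> f; apply: endoP => a /=; rewrite addNr. Qed.

Let mulA : associative mul.
Proof. by move=> f g h; apply: endoP. Qed.

Let mul1 : left_id one mul.
Proof. by move=> f; apply: endoP. Qed.

Let mulr1_ : right_id one mul.
Proof. by move=> f; apply: endoP. Qed.

Let mulDl : left_distributive mul add.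
Proof. by move=> f g h; apply: endoP. Qed.

Let mulDr : right_distributive mul add.
Proof. by move=> f g h; apply: endoP => a /=; rewrite raddfD. Qed.

HB.instance Definition _ := GRing.isPzRing.Build endo
  addA addC add0 addN mulA mul1 mulr1_ mulDl mulDr.

Lemma endo0E (a : A) : (0 : endo) a = 0. Proof. by []. Qed.
Lemma endoDE f g (a : A) : (f + g) a = f a + g a. Proof. by []. Qed.
Lemma endoNE f (a : A) : (- f) a = - f a. Proof. by []. Qed.
Lemma endo1E (a : A) : (1 : endo) a = a. Proof. by []. Qed.
Lemma endoME f g (a : A) : (f * g) a = f (g a). Proof. by []. Qed.

Definition annihilator (K : set A) : set endo :=
  [set f | forall a, K a -> f a = 0].

Let fin_open : set_system endo := [set U | forall f, U f ->
  exists2 K : set A, finite_set K & forall g, annihilator K (g - f) -> U g].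

Let fin_openT : fin_open setT.
Proof. by move=> f _; exists set0. Qed.

Let fin_openI : setI_closed fin_open.
Proof.
move=> U V oU oV f [/oU[K finK KU] /oV[L finL LV]].
exists (K `|` L); first by rewrite finite_setU.
by move=> g gKL; split; [apply: KU|apply: LV] => a ?; apply: gKL; [left|right].
Qed.

Let fin_open_bigcup (F : set_system endo) :
  F `<=` fin_open -> fin_open (\bigcup_(U in F) U).
Proof.
move=> Fo f [U FU /(Fo U FU)[K finK KU]].
by exists K => // g /KU; exists U.
Qed.

(* The translation-invariant topology with the sets [annihilator K], [K] finite,
   as a fundamental system of neighborhoods of 0. *)
Definition finite_topology : topology_on endo :=
  Topology fin_openT fin_openI fin_open_bigcup.

Lemma nbhs_finite_topology (f : topologized finite_topology) :
  nbhs f = filter_from finite_set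
    (fun K => [set g : topologized finite_topology | annihilator K (g - f)]).
Proof.
apply/seteqP; split=> [U [V [oV Vf VU]]|U [K finK KU]].
  by have [K finK KV] := oV _ Vf; exists K => // g /KV /VU.
exists [set g : endo | annihilator K (g - f)]; split => //; last first.
  by move=> a _; rewrite subrr.
move=> g gK; exists K => // h hK a Ka.
by rewrite -(subrKA g) endoDE (hK a Ka) (gK a Ka) addr0.
Qed.

Lemma nbhs0_finite_topology :
  nbhs (0 : topologized finite_topology) = filter_from finite_set annihilator.
Proof.
rewrite nbhs_finite_topology; congr filter_from; apply/funext => K.
by apply/seteqP; split => g /=; rewrite subr0.
Qed.

End Endomorphisms.

(* Main.v *)
Require Import Defs.
From HB Require Import structures.
From mathcomp Require Import all_boot all_order all_algebra.
From mathcomp Require Import all_classical all_reals all_analysis.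

Set Implicit Arguments.
Unset Strict Implicit.
Unset Printing Implicit Defensive.

Import GRing.Theory.

Local Open Scope classical_set_scope.
Local Open Scope card_scope.
Local Open Scope ring_scope.

(** The finite topology has the required properties because it is the topology
    of pointwise convergence on the countable discrete group A.  Uniqueness
    rests on Baire's theorem for complete metrizable groups ([baire]), used once
    for each of two inclusions.  Let tau be a topology as in the theorem.

    The finite topology is coarser than tau ([annihilator1_nbhs]).  For a <> 0
    let e be an additive projection of A onto the line generated by a
    ([line_projection]).  For endomorphisms f and g one has f a = g a if and
    only if f e = g e, and right multiplication by e is tau-continuous, so every
    set {f | f a = b} is tau-closed.  There are countably many of them and they
    cover End(A), so by Baire one of them has an interior point; translating it
    to the origin shows that {f | f a = 0} is a tau-neighborhood of 0.

    The finite topology is finer than tau ([open_mapping]).  By the previous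
    step the identity from (End(A), tau) to End(A) with the finite topology is
    a continuous additive bijection between complete metrizable second
    countable groups, so it is open by the open mapping theorem. *)

(** * Countable sets and additive groups of topological rings *)

Lemma countable_enum (T : Type) (B : set T) : countable B -> B !=set0 ->
  exists b : nat -> T, range b = B.
Proof.
move=> /pfcard_geP[->[x []]|[b] _]; exists b.
exact: image_eq.
Qed.

Section AdditiveGroup.
Variable X : preTopologicalPzRingType.
Hypothesis addC : continuous (fun x : X * X => x.1 + x.2).
Hypothesis oppC : continuous (-%R : X -> X).

Lemma nbhs_sub (x y : X) (N : set X) : nbhs (x - y) N ->
  exists P Q, [/\ nbhs x P, nbhs y Q & forall u v, P u -> Q v -> N (u - v)].
Proof.
move=> /(addC (x := (x, - y)))[[P Q] /= [Px Qy] PQN].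
by exists P, (-%R @^-1` Q); split=> // [|u v Pu Qv];
  [exact: oppC|apply: (PQN (u, - v))].
Qed.

Lemma nbhs_shift (x y : X) (N : set X) :
  nbhs (x + y) N -> nbhs y [set z | N (x + z)].
Proof.
move=> /(addC (x := (x, y)))[[P Q] /= [/nbhs_singleton Px Qy] PQN].
by apply: filterS Qy => z Qz; apply: (PQN (x, z)).
Qed.

Lemma nbhs_shift0 (x : X) (N : set X) :
  nbhs 0 N -> nbhs x [set z | N (z - x)].
Proof.
rewrite -[X in nbhs X _](addNr x) => /nbhs_shift.
by apply: filterS => z; rewrite /= addrC.
Qed.

Lemma nbhs0_halve (U : set X) : nbhs 0 U ->
  exists V, [/\ nbhs 0 V, forall x, V x -> V (- x) &
    forall x y, V x -> V y -> U (x + y)].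
Proof.
rewrite -[X in nbhs X _](subr0 0) => /nbhs_sub[P [Q [P0 Q0 PQU]]].
have N0 W : nbhs (0 : X) W -> nbhs (0 : X) (-%R @^-1` W).
  by move=> W0; apply: oppC; rewrite oppr0.
exists ((P `&` Q) `&` -%R @^-1` (P `&` Q)); split.
- by apply: filterI; [|apply: N0]; apply: filterI.
- by move=> x [? ?]; split; rewrite //= opprK.
by move=> x y [[Px _] _] [_ [_ Qy]]; rewrite -[y]opprK; apply: PQU.
Qed.

(** A countable base of symmetric neighborhoods of 0 that plays the part of the
    balls of radius 2^-n of an invariant metric. *)
Definition halving_base (V : nat -> set X) :=
  [/\ forall n, nbhs 0 (V n),
      forall n x, V n x -> V n (- x),
      forall n x y, V n.+1 x -> V n.+1 y -> V n (x + y) &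
      forall U, nbhs 0 U -> exists n, V n `<=` U].

(** As for the Birkhoff-Kakutani theorem: V (n+1) is obtained by halving the
    intersection of V n with the n-th member of the given countable base. *)
Lemma first_countable_halving_base : first_countable X ->
  exists V, halving_base V.
Proof.
move=> /(_ 0)[B [cB Bnbhs Bcvg]].
have [W BW _] := Bcvg _ (filterT : nbhs 0 setT).
have [b bE] := countable_enum cB (ex_intro _ W BW).
have b0 n : nbhs (0 : X) (b n) by apply: Bnbhs; rewrite -bE; exists n.
pose good (U V : set X) := nbhs 0 U -> [/\ nbhs 0 V,
  forall x, V x -> V (- x) & forall x y, V x -> V y -> U (x + y)].
have [h hP] : {h & forall U, good U (h U)}.
  (* [setT] is a junk value for the sets that are not neighborhoods of 0 *)
  apply: choice => U; have [/nbhs0_halve[V ?]|nU] := pselect (nbhs 0 U).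
    by exists V.
  by exists setT.
pose V := fix V n := h (if n is m.+1 then V m `&` b m else setT).
have V0 n : nbhs 0 (V n).
  elim: n => [|n IH] /=; first by have [] := hP _ filterT.
  by have [] := hP _ (filterI IH (b0 n)).
exists V; split => //.
- case=> [|n] x /=; first by have [_ + _] := hP _ filterT; apply.
  by have [_ + _] := hP _ (filterI (V0 n) (b0 n)); apply.
- move=> n x y Vx Vy.
  by have [_ _ /(_ x y Vx Vy)[]] := hP _ (filterI (V0 n) (b0 n)).
move=> U U0; have [W' BW' W'U] := Bcvg _ U0.
have [n _ nE] : range b W' by rewrite bE.
exists n.+1; apply: subset_trans W'U; rewrite -nE => x Vx.
have [_ _ /(_ x 0 Vx)[|_]] := hP _ (filterI (V0 n) (b0 n)).
  exact: (nbhs_singleton (V0 n.+1)).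
by rewrite addr0.
Qed.

Section HalvingBase.
Variable V : nat -> set X.
Hypothesis Vbase : halving_base V.

Lemma halving_base0 n : V n 0.
Proof. by have [+ _ _ _] := Vbase; move/(_ n)/nbhs_singleton. Qed.

Lemma halving_base_nonincr m n : (m <= n)%N -> V n `<=` V m.
Proof.
move=> /subnK <-; elim: (n - m)%N => [//|k IH] x.
rewrite addSn => Vx; apply: IH; rewrite -[x]addr0.
by have [_ _ + _] := Vbase; apply; rewrite //; apply: halving_base0.
Qed.

(** The jumps of u decrease geometrically, so u is a Cauchy sequence, and
    its tail after n sums up to an element of V (k n).  The shift by 2 pays for
    two halvings: one to sum the jumps, one to pass to the limit.  The depth k
    is arbitrary because in Baire's theorem it is chosen along with u. *)
Lemma chain_limit (u : nat -> X) (k : nat -> nat) : add_complete X ->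
    {homo k : m n / (m < n)%N} ->
    (forall n, V (k n).+2 (u n.+1 - u n)) ->
  exists x : X, forall n, V (k n) (x - u n).
Proof.
move=> Xc kincr uV; have [V0 VN VD VU] := Vbase.
have uV' n m : V (k n).+1 (u (m + n)%N - u n).
  elim: m n => [|m IH] n; first by rewrite subrr; apply: halving_base0.
  rewrite -(subrKA (u n.+1)) addSnnS; apply: VD (uV n).
  by apply: halving_base_nonincr (IH n.+1); rewrite ltnS; apply: kincr.
have k_ge n : (n <= k n)%N.
  by elim: n => // n IH; apply: leq_ltn_trans IH _; apply: kincr.
have uV2 n m : (n <= m)%N -> V (k n).+1 (u m - u n).
  by move=> /subnK <-.
have [x ux] : exists x : X, u @ \oo --> x.
  apply: (Xc (u @ \oo) (fmap_proper_filter _ _)) => U [W W0 WU].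
  have [n VW] := VU _ W0.
  exists (u @` [set m | (n <= m)%N], u @` [set m | (n <= m)%N]).
    by split; exists n => // m /= nm; exists m.
  move=> [_ _] /= [[m nm <-] [l nl <-]]; apply: WU; apply: VW => /=.
  apply: (halving_base_nonincr (k_ge n)).
  rewrite -(subrKA (u n)) -[u n - _]opprB.
  by apply: VD; [|apply: VN]; exact: uV2.
exists x => n.
have /ux [M _ MV] := nbhs_shift0 x (V0 (k n).+1).
rewrite -(subrKA (u (n + M)%N)); apply: VD; last by apply: uV2; exact: leq_addr.
by rewrite -opprB; apply: VN; apply: (MV (n + M)%N); exact: leq_addl.
Qed.

End HalvingBase.

(** If no F n had an interior point, each ball would contain a smaller ball that
    avoids F n, because F n is closed; the centers of nested balls chosen so for
    n = 0, 1, ... would converge to a point that lies in no F n. *)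
Lemma baire (F : nat -> set X) : add_complete X -> first_countable X ->
    (forall n, closed (F n)) -> (forall x, exists n, F n x) ->
  exists n (x : X), nbhs x (F n).
Proof.
move=> Xc /first_countable_halving_base[V Vbase] Fcl Fcov.
have [V0 VN VD VU] := Vbase.
apply: contrapT => nF.
have avoid n (xk : X * nat) : exists yl : X * nat,
    [/\ V xk.2.+2 (yl.1 - xk.1), (xk.2 < yl.2)%N &
        forall z, V yl.2 (z - yl.1) -> ~ F n z].
  (* [xk.2.+2] leaves room for the later jumps, as [chain_limit] requires *)
  have [y Vy nFy] : exists2 y, V xk.2.+2 (y - xk.1) & ~ F n y.
    apply: contrapT => H; apply: nF; exists n, xk.1.
    apply: filterS (nbhs_shift0 xk.1 (V0 xk.2.+2)) => y Vy.
    by apply: contrapT => nFy; apply: H; exists y.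
  have : nbhs y (~` F n) by apply: open_nbhs_nbhs; split; rewrite ?openC.
  rewrite -[y]addr0 => /nbhs_shift/VU[l Vl]; exists (y, maxn l xk.2.+1).
  rewrite /= leq_maxr; split => // z Vz Fz.
  have /Vl := halving_base_nonincr Vbase (leq_maxl l xk.2.+1) Vz.
  by rewrite /= addrC subrK.
have /choice[s sP] := fun t : nat * (X * nat) => avoid t.1 t.2.
pose w := fix w n := if n is m.+1 then s (m, w m) else (0, 0%N).
have [||x xV] := chain_limit Vbase (u := fun n => (w n).1)
    (k := fun n => (w n).2) Xc.
- by apply: homo_ltn => [? ? ?|n]; [apply: ltn_trans|have [] := sP (n, w n)].
- by move=> n; have [] := sP (n, w n).
have [n Fx] := Fcov x.
by have [_ _ /(_ x)] := sP (n, w n); apply => //; exact: (xV n.+1).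
Qed.

End AdditiveGroup.

(** * The open mapping theorem *)

(** The closure of the image of a neighborhood of 0 is a neighborhood of 0:
    countably many translates of V (n+1) cover X, so by Baire the closure of the
    image of one of them has an interior point, and differences of points of
    this translate lie in V n.  A successive approximation then removes the
    closure: y = f (x_0 + x_1 + ...), where x_m in V (n+m+2) is chosen so that
    the remainder lies in the closure of f (V (n+m+3)). *)
Lemma open_mapping (X Y : preTopologicalPzRingType) (f : X -> Y) :
    continuous (fun x : X * X => x.1 + x.2) -> continuous (-%R : X -> X) ->
    continuous (fun y : Y * Y => y.1 + y.2) -> continuous (-%R : Y -> Y) ->
    first_countable X -> @second_countable X -> add_complete X ->
    first_countable Y -> add_complete Y -> hausdorff_space Y ->
    {morph f : x y / x + y} -> continuous f -> (forall y, exists x, f x = y) ->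
  forall U, nbhs 0 U -> nbhs 0 (f @` U).
Proof.
move=> addX oppX addY oppY X1 [B cB [Bopen Bbasis]] Xc Y1 Yc Yh fD fcont fsurj.
have f0 : f 0 = 0 by apply: (addrI (f 0)); rewrite -fD !addr0.
have fN x : f (- x) = - f x by apply: (addrI (f x)); rewrite -fD !subrr.
have [V Vbase] := first_countable_halving_base addX oppX X1.
have [V0 VN VD VU] := Vbase.
have clV n : nbhs 0 (closure (f @` V n)).
  (* [d] runs through a dense sequence: one point in each basic open set *)
  have [C BC _] := Bbasis _ _ (filterT : nbhs 0 setT).
  have [b bE] := countable_enum cB (ex_intro _ C BC.1).
  have /choice[d dP] i : exists x : X, b i !=set0 -> b i x.
    have [[x bx]|n0] := pselect (b i !=set0).
      by exists x.
    by exists 0.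
  pose F i := closure (f @` [set x | V n.+1 (x - d i)]).
  have [|y|i [y Fy]] := baire addY oppY (F := F) Yc Y1.
  - by move=> i; exact: closed_closure.
  - have [x <-] := fsurj y.
    have Vx : nbhs x [set z | V n.+1 (x - z)].
      apply: filterS (nbhs_shift0 addX x (V0 n.+1)) => z /VN.
      by rewrite opprB.
    have [W [BW Wx] WV] := Bbasis _ _ Vx.
    have [i _ iE] : range b W by rewrite bE.
    exists i; apply: subset_closure; exists x => //=; apply: WV.
    by rewrite -iE; apply: dP; exists x; rewrite iE.
  move: (Fy); rewrite -[y]addr0 => /(nbhs_shift addY); apply: filterS => z.
  rewrite /= => Fyz N.
  have {1}-> : z = y + z - y by rewrite addrC addKr.
  move=> /(nbhs_sub addY oppY)[P [Q [Pyz Qy PQN]]].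
  have [_ [[x Vx <-] Px]] := Fyz _ Pyz.
  have [_ [[x' Vx' <-] Qx']] := nbhs_singleton Fy _ Qy.
  exists (f x - f x'); split; last exact: PQN.
  exists (x - x'); last by rewrite fD fN.
  rewrite -(subrKA (d i)) -[d i - _]opprB.
  by apply: VD => //; apply: VN.
move=> U /VU[n VU'].
apply: filterS (clV n.+2) => y yV.
have step m (x : X) : exists x' : X,
    closure (f @` V m) (y - f x) ->
    V m (x' - x) /\ closure (f @` V m.+1) (y - f x').
  have [H|nH] := pselect (closure (f @` V m) (y - f x)); last by exists x.
  have /H[_ [[v Vv <-]]] : nbhs (y - f x)
      [set z | closure (f @` V m.+1) (y - f x - z)].
    have : nbhs (y - f x - (y - f x)) (closure (f @` V m.+1)).
      by rewrite subrr.
    move=> /(nbhs_sub addY oppY)[P [Q [Pz Qz PQ]]].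
    by apply: filterS Qz => z; apply: PQ; exact: nbhs_singleton.
  move=> /= vcl; exists (x + v) => _; split.
    by rewrite addrC addKr.
  by rewrite fD opprD addrA.
have /choice[s sP] := fun t : nat * X => step t.1 t.2.
pose w := fix w m := if m is l.+1 then s ((n + l).+2, w l) else 0.
have wcl m : closure (f @` V (n + m).+2) (y - f (w m)).
  elim: m => [|m IH]; first by rewrite addn0 /= f0 subr0.
  by rewrite addnS; have [] := sP (_, _) IH.
(* the partial sums [w] of the approximation have a limit [x] in V n *)
have [||x xV] := chain_limit addX Vbase (u := w) (k := addn n) Xc.
- by move=> i j; rewrite ltn_add2l.
- by move=> m; have [] := sP (_, _) (wcl m).
exists x; first by apply: VU'; have := xV 0%N; rewrite subr0 addn0.
(* f (w m + v) is near f x and y if f v approximates the m-th remainder *)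
apply: Yh => P Q /fcont; rewrite -[x]addr0 => /(nbhs_shift addX)/VU[l Vl] Qy.
have /wcl[_ [[v Vv <-]]] : nbhs (y - f (w l.+1)) [set z | Q (f (w l.+1) + z)].
  by apply: nbhs_shift => //; rewrite addrC subrK.
rewrite /= -fD => Qwv; exists (f (w l.+1 + v)); split => //.
rewrite -[w _](subrK x) -addrA [x + v]addrC addrA [_ + x]addrC; apply: Vl => /=.
apply: VD; first rewrite -opprB; first apply: VN.
  by apply: halving_base_nonincr (xV l.+1) => //; exact: leq_addl.
apply: halving_base_nonincr Vv => //.
by rewrite !leqW ?leq_addl.
Qed.

(** * The finite topology *)

Section FiniteTopology.
Variable A : zmodType.
Local Notation X := (topologized (finite_topology A)).

Lemma annihilator_subP (K : set A) (f g : endo A) :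
  annihilator K (g - f) <-> forall a, K a -> g a = f a.
Proof.
split=> gK a /gK; rewrite endoDE endoNE;
  by [exact: subr0_eq|move=> ->; exact: subrr].
Qed.

Lemma nbhs_finite_topologyP (f : X) (U : set X) : nbhs f U <->
  exists2 K : set A, finite_set K & forall g : endo A,
    (forall a, K a -> g a = (f : endo A) a) -> U g.
Proof.
rewrite nbhs_finite_topology; split => -[K finK KU]; exists K => // g gK;
  by apply: KU; apply/annihilator_subP.
Qed.

Lemma nbhs_finite_topology1 (f : X) (a : A) :
  nbhs f [set g : X | (g : endo A) a = (f : endo A) a].
Proof. by apply/nbhs_finite_topologyP; exists [set a] => // g; apply. Qed.

Lemma finite_topology_add : continuous (fun x : X * X => x.1 + x.2).
Proof.
move=> [f g] U /nbhs_finite_topologyP[K finK KU].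
exists ([set f' : X | forall a, K a -> (f' : endo A) a = (f : endo A) a],
        [set g' : X | forall a, K a -> (g' : endo A) a = (g : endo A) a]).
  by split; apply/nbhs_finite_topologyP; exists K.
move=> [f' g'] /= [f'K g'K]; apply: KU => a Ka.
by rewrite !endoDE f'K// g'K.
Qed.

Lemma finite_topology_opp : continuous (-%R : X -> X).
Proof.
move=> f U /nbhs_finite_topologyP[K finK KU].
apply/nbhs_finite_topologyP; exists K => // g gK.
by apply: KU => a Ka; exact: (congr1 -%R (gK a Ka)).
Qed.

Lemma finite_topology_mul : continuous (fun x : X * X => x.1 * x.2).
Proof.
move=> [f g] U /nbhs_finite_topologyP[K finK KU].
exists ([set f' : X | forall b, ((g : endo A) @` K) b ->
           (f' : endo A) b = (f : endo A) b],
        [set g' : X | forall a, K a -> (g' : endo A) a = (g : endo A) a]).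
  split; apply/nbhs_finite_topologyP; last by exists K.
  by exists ((g : endo A) @` K) => //; exact: finite_image.
move=> [f' g'] /= [f'K g'K]; apply: KU => a Ka.
rewrite -[LHS]/((f' : endo A) ((g' : endo A) a)) g'K // f'K //; by exists a.
Qed.

Lemma finite_topology_hausdorff : hausdorff_space X.
Proof.
move=> f g fg; apply: endoP => a.
have [h [/= <- <-]//] := fg _ _ (nbhs_finite_topology1 f a)
  (nbhs_finite_topology1 g a).
Qed.

(** A basic neighborhood of f is clopen, so it is enough to separate by its
    characteristic function, whose values lie in a discrete uniform space. *)
Lemma finite_topology_completely_regular : completely_regular_space X.
Proof.
move=> f B Bcl nBf.
have /nbhs_finite_topologyP[K finK KB] : nbhs f (~` B).
  by apply: open_nbhs_nbhs; split; rewrite ?openC.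
pose same (g : X) := `[< forall a, K a -> (g : endo A) a = (f : endo A) a >].
exists (Uniform.class (initial_topology same)).
exists [set gh | same gh.1 = same gh.2]; split.
- exists [set xy | xy.1 = xy.2] => //.
  by rewrite uniform_discrete => _ [x _ <-].
- apply/seteqP; split => // -[_ h] /= [[-> Bh]].
  rewrite /same /=.
  have -> : `[< forall a, K a -> (f : endo A) a = (f : endo A) a >].
    exact/asboolP.
  by move=> /esym/asboolP/KB.
move=> g U [V [[W Wo <-] /= Wg]] WU.
apply/nbhs_finite_topologyP; exists K => // h hg.
apply: WU => /=; suff -> : same h = same g by [].
by apply/asbool_equiv_eq; split=> H a Ka; [rewrite -hg|rewrite hg]; rewrite ?H.
Qed.

(** For each a, a Cauchy filter contains a set of endomorphisms that agree at a;
    their common value defines the limit at a. *)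
Lemma finite_topology_complete : add_complete X.
Proof.
move=> F FF Fcauchy.
have /choice[phi Fphi] a : exists b, F [set g : X | (g : endo A) a = b].
  have [] := Fcauchy [set fg | (fg.1 - fg.2 : endo A) a = 0].
    exists [set g : X | (g : endo A) a = 0] => //.
    exact: nbhs_finite_topology1 0 a.
  move=> [P Q] /= [FP FQ] PQ; have [f Pf] := filter_ex FP.
  exists ((f : endo A) a); apply: filterS FQ => g Qg /=.
  exact/esym/subr0_eq/(PQ (f, g)).
have phiB : zmod_morphism phi.
  move=> a b.
  have [g [[/= <- <-] <-]] :=
    filter_ex (filterI (filterI (Fphi a) (Fphi b)) (Fphi (a - b))).
  by rewrite raddfB.
pose f : endo A := HB.pack phi (GRing.isZmodMorphism.Build A A phi phiB).
exists f => U /nbhs_finite_topologyP[K /finite_fsetP[D ->] KU].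
have := filter_bigI (D := D) FF (fun a _ => Fphi a).
by apply: filterS => g gD; apply: KU => a aD; exact: gD.
Qed.

Section CountableGroup.
Variables (c : nat -> A) (csurj : forall a, exists n, c n = a).

Lemma finite_set_enum (K : set A) : finite_set K ->
  exists n, forall a, K a -> exists2 i, (i < n)%N & c i = a.
Proof.
move=> /finite_fsetP[D ->].
have /choice[i iP] := csurj.
exists (\max_(a <- finmap.enum_fset D) (i a).+1)%N => a aD; exists (i a) => //.
exact: (leq_bigmax_seq (F := fun a => (i a).+1)).
Qed.

Lemma finite_topology_first_countable : first_countable X.
Proof.
move=> f; exists (range (fun n => [set g : X | forall i, (i < n)%N ->
  (g : endo A) (c i) = (f : endo A) (c i)])); split.
- exact: card_image_le.
- move=> _ [n _ <-]; apply/nbhs_finite_topologyP; exists (c @` `I_n).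
    exact/finite_image/finite_II.
  by move=> g gK i ilt; apply: gK; exists i.
move=> U /nbhs_finite_topologyP[K /finite_set_enum[n nK] KU].
exists [set g : X | forall i, (i < n)%N ->
  (g : endo A) (c i) = (f : endo A) (c i)]; first by exists n.
by move=> g /= gn; apply: KU => a /nK[i ilt <-]; exact: gn.
Qed.

Lemma finite_topology_second_countable : @second_countable X.
Proof.
pose C (s : seq nat) := [set g : X | forall i, (i < size s)%N ->
  (g : endo A) (c i) = c (nth 0%N s i)].
exists (range C); first exact/(card_le_trans (card_image_le _ _))/countableP.
split=> [_ [s _ <-]|f U /nbhs_finite_topologyP[K /finite_set_enum[n nK] KU]].
  rewrite openE => f fs; apply/nbhs_finite_topologyP; exists (c @` `I_(size s)).
    exact/finite_image/finite_II.
  by move=> g gf i ilt; rewrite -(fs i ilt); apply: gf; exists i.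
have /choice[s sP] i : exists m, c m = (f : endo A) (c i) by exact: csurj.
exists (C (mkseq s n)).
  split; first by exists (mkseq s n).
  by move=> i; rewrite size_mkseq => ilt; rewrite nth_mkseq.
move=> g gC; apply: KU => a /nK[i ilt <-].
by rewrite gC ?size_mkseq// nth_mkseq// sP.
Qed.

End CountableGroup.
End FiniteTopology.

(** * Lines in an elementary abelian group *)

Section ElementaryGroup.
Variables (p : nat) (A : zmodType).
Hypothesis p_prime : prime p.
Hypothesis A_elementary : forall a : A, a *+ p = 0.

(** A is a vector space over the field with p elements: an integer acts either
    as 0 or, by Bezout, as an invertible scalar. *)
Lemma elementary_mulrz (a : A) (n : int) :
  a *~ n = 0 \/ exists u, a *~ n *~ u = a.
Proof.
have Ap (q : int) : a *~ (q * p) = 0.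
  by rewrite mulrzA -pmulrn A_elementary.
have [/dvdzP[q ->]|pn] := boolP (p %| n)%Z; [by left|right].
have /coprimezP[[u v] /= uv] : coprimez n p.
  by rewrite coprimezE coprime_sym prime_coprime.
by exists u; rewrite -mulrzA mulrC -[LHS]addr0 -(Ap v) -mulrzDr_tmp uv.
Qed.

(** Let H be a subgroup maximal among those that do not contain a.  If x is not
    in H, then a lies in H + <x>, hence x lies in H + <a>; so H is a complement
    of the line <a>, and e is the projection along H. *)
Lemma line_projection (a : A) : a != 0 ->
  exists e : endo A, e a = a /\ forall x, exists k, e x = a *~ k.
Proof.
move=> a0.
have subACA (x y z t : A) : x - y - (z - t) = x - z - (y - t).
  by rewrite !opprB addrACA [RHS]addrACA [- y - z]addrC.
pose P := [set H : set A | (forall x y, H x -> H y -> H (x - y)) /\ ~ H a].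
have [|H [[HB nHa] Hmax]] := @Zorn_bigcup A P.
  move=> F FP Ftot; split; last by move=> [H /FP[_ +] /=].
  move=> x y [H FH Hx] [L FL Ly].
  have [HL|LH] := Ftot _ _ FH FL.
    by exists L => //; apply: (FP _ FL).1 => //; exact: HL.
  by exists H => //; apply: (FP _ FH).1 => //; exact: LH.
have Hext (L : set A) : H `<=` L -> (forall x y, L x -> L y -> L (x - y)) ->
    ~ L a -> L `<=` H.
  move=> HL LB nLa; apply: contrapT => nLH.
  exact: (Hmax L (conj HL nLH)).
(* the empty set is admitted in [P], for the union of the empty chain *)
have H0 : H 0.
  have [[h Hh]|Hempty] := pselect (H !=set0).
    by rewrite -(subrr h); exact: HB.
  apply: (Hext [set 0]) => //.
  - by move=> x Hx; exfalso; apply: Hempty; exists x.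
  - by move=> x y /= -> ->; rewrite subrr.
  - by move/eqP; apply/negP.
have HN x : H x -> H (- x) by move=> Hx; rewrite -sub0r; exact: HB.
have HD x y : H x -> H y -> H (x + y).
  by move=> Hx /HN Hy; rewrite -[y]opprK; exact: HB.
have HZ x n : H x -> H (x *~ n).
  move=> Hx; have HM m : H (x *+ m).
    by elim: m => // m IH; rewrite mulrS; exact: HD.
  by case: n => n; [|rewrite NegzE mulrNz; apply: HN]; exact: HM.
have Hline x : exists k, H (x - a *~ k).
  apply: contrapT => nk.
  pose L := [set z | exists n, H (z - x *~ n)].
  have HL : H `<=` L by move=> z Hz; exists 0; rewrite mulr0z subr0.
  have La : L a.
    apply: contrapT => nLa; apply: nk; exists 0; rewrite mulr0z subr0.
    apply: (Hext L HL _ nLa); last by exists 1; rewrite mulr1z subrr.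
    move=> y z [m Hy] [n Hz]; exists (m - n).
    by rewrite mulrzBr subACA; exact: HB.
  have [n Hn] := La.
  have [xn0|[u xnu]] := elementary_mulrz x n.
    by apply: nHa; rewrite -(subr0 a) -xn0.
  apply: nk; exists u; rewrite -opprB; apply: HN.
  by rewrite -{1}xnu -mulrzBl; exact: HZ.
have /choice[k kP] := Hline.
have aH n : H (a *~ n) -> a *~ n = 0.
  move=> Hn; have [//|[u anu]] := elementary_mulrz a n.
  by exfalso; apply: nHa; rewrite -anu; exact: HZ.
have eB : zmod_morphism (fun x => a *~ k x).
  move=> x y; apply/eqP; rewrite -subr_eq0; apply/eqP.
  rewrite -!mulrzBr; apply: aH; rewrite !mulrzBr.
  have := HB _ _ (HB _ _ (kP x) (kP y)) (kP (x - y)).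
  by rewrite (subACA x) (subACA (x - y)) subrr sub0r opprB.
pose e : endo A := HB.pack (fun x => a *~ k x)
  (GRing.isZmodMorphism.Build A A _ eB).
exists e; split=> [|x]; last by exists (k x).
rewrite /=; apply/esym/eqP; rewrite -subr_eq0; apply/eqP.
have := kP a; rewrite -{1 3}[a]mulr1z -mulrzBr; exact: aH.
Qed.
End ElementaryGroup.

(** * Uniqueness *)

Section Uniqueness.
Variables (p : nat) (A : zmodType).
Hypothesis p_prime : prime p.
Hypothesis A_elementary : forall a : A, a *+ p = 0.
Variables (c : nat -> A) (csurj : forall a, exists n, c n = a).

(** The left ideal of the endomorphisms that vanish at a is closed, because it
    is the annihilator of a projection onto <a>, and has countable index,
    because its cosets correspond to values at a; a closed subgroup of countable
    index of a complete metrizable group is open. *)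
Lemma annihilator1_nbhs (tau : topology_on (endo A)) (a : A) :
    ring_topology (topologized tau) -> first_countable (topologized tau) ->
    add_complete (topologized tau) ->
  nbhs (0 : topologized tau) [set f : topologized tau | (f : endo A) a = 0].
Proof.
move=> [addC oppC mulC _ T2] fc cpl.
have [->|a0] := eqVneq a 0.
  by apply: filterE => f /=; exact: (raddf0 (f : endo A)).
have [e [ea eline]] := line_projection p_prime A_elementary a0.
pose F n := [set f : topologized tau | (f : endo A) a = c n].
have Fcl n : closed (F n).
  have [[g ga]|F0] := pselect (F n !=set0); last first.
    have -> : F n = set0 by apply/seteqP; split => // f Ff; apply: F0; exists f.
    exact: closed0.
  have -> : F n = (fun f : topologized tau => f * (e : topologized tau)) @^-1`
                  [set g * (e : topologized tau)].
    apply/seteqP; split => f.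
      rewrite /F /= -ga => fa; apply: (@endoP A (f * e) (g * e)) => x.
      rewrite !endoME; have [k ->] := eline x.
      by rewrite (raddfMz (f : endo A)) (raddfMz (g : endo A)) fa.
    move=> /= fge; rewrite /F /= -ga -ea.
    rewrite -[LHS](@endoME A f e) -[RHS](@endoME A g e).
    by have -> : (f : endo A) * e = (g : endo A) * e by exact: fge.
  apply: closed_comp; last first.
    exact/accessible_closed_set1/hausdorff_accessible.
  move=> f _ U /(mulC (f, (e : topologized tau)))[[P Q] /=].
  move=> [Pf /nbhs_singleton Qe] PQU.
  by apply: filterS Pf => h Ph; apply: (PQU (h, _)).
have [n [f Ff]] : exists n (f : topologized tau), nbhs f (F n).
  apply: baire => // f; have [n cn] := csurj ((f : endo A) a).
  by exists n; rewrite /F /= cn.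
have fa := nbhs_singleton Ff.
move: Ff; rewrite -[X in nbhs X _]addr0 => /(nbhs_shift addC).
apply: filterS => g fga; apply: (addrI ((f : endo A) a)).
by rewrite addr0 {2}fa; exact: fga.
Qed.

Lemma nbhs0_finite_topology_sub (tau : topology_on (endo A))
    (U : set (endo A)) :
    ring_topology (topologized tau) -> first_countable (topologized tau) ->
    add_complete (topologized tau) ->
  nbhs (0 : topologized (finite_topology A)) U -> nbhs (0 : topologized tau) U.
Proof.
move=> tr fc cpl /nbhs_finite_topologyP[K /finite_fsetP[D ->] KU].
have := filter_bigI (D := D) (nbhs_filter (0 : topologized tau))
  (fun a _ => annihilator1_nbhs a tr fc cpl).
by apply: filterS => g gD; apply: KU => a aD; exact: gD.
Qed.

End Uniqueness.

Lemma topology_on_ext (T : Type) (tau sigma : topology_on T) :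
  opens tau = opens sigma -> tau = sigma.
Proof.
case: tau sigma => [P PT PI PU] [Q QT QI QU] /= PQ; subst Q.
by congr Topology; exact: Prop_irrelevance.
Qed.

(** The topology of a group is determined by the neighborhoods of 0. *)
Lemma opens_nbhs0 (R : pzRingType) (tau : topology_on R) :
    continuous (fun x : topologized tau * topologized tau => x.1 + x.2) ->
  opens tau = [set U | forall x, U x ->
    nbhs (0 : topologized tau) [set y | U (x + y)]].
Proof.
move=> addC; rewrite -open_topologizedE openE.
apply/seteqP; split=> U oU x Ux.
  by apply: (nbhs_shift addC); rewrite addr0; exact: oU.
apply: filterS (nbhs_shift0 addC x (oU x Ux)) => y /=.
by rewrite addrC subrK.
Qed.

Theorem theorem5 (p : nat) (A : zmodType)
    (p_prime : prime p)
    (A_elementary : forall a : A, a *+ p = 0)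
    (A_countable : [set: A] #= [set: nat]) :
  let good (tau : topology_on (endo A)) :=
    [/\ ring_topology (topologized tau),
        second_metrizable (topologized tau) &
        add_complete (topologized tau)] in
  good (finite_topology A) /\
  forall tau : topology_on (endo A), good tau -> tau = finite_topology A.
Proof.
move=> good.
have [c cE] : exists c : nat -> A, range c = setT.
  apply: countable_enum; last by exists 0.
  by rewrite /countable; have := A_countable; rewrite card_eq_le => /andP[].
have csurj a : exists n, c n = a.
  by have [n _ <-] : range c a; [rewrite cE|exists n].
have fin1 := finite_topology_first_countable csurj.
have finD := @finite_topology_add A.
have finN := @finite_topology_opp A.
have finT2 := @finite_topology_hausdorff A.
have finc := @finite_topology_complete A.
split.
  split => //; split => //.
  - exact: finite_topology_mul.
  - exact: finite_topology_completely_regular.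
  - exact: finite_topology_second_countable.
move=> tau [taur [tau1 tau2] tauc].
have [tauD tauN _ _ _] := taur.
have sub U := nbhs0_finite_topology_sub (U := U) p_prime A_elementary csurj
  taur tau1 tauc.
apply: topology_on_ext; rewrite !opens_nbhs0 //.
suff -> : nbhs (0 : topologized tau) =
  nbhs (0 : topologized (finite_topology A)) by [].
apply/seteqP; split => U; last exact: sub.
move=> U0.
have idcont :
  continuous (idfun : topologized tau -> topologized (finite_topology A)).
  move=> f V; rewrite -[X in nbhs X _]addr0 => /(nbhs_shift finD)/sub V0.
  apply: filterS (nbhs_shift0 tauD f V0) => g /=.
  by rewrite [_ + (g - f)]addrC subrK.
have := open_mapping tauD tauN finD finN tau1 tau2 tauc fin1 finc finT2
  (fun _ _ => erefl) idcont (fun y => ex_intro _ y erefl) U0.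
by rewrite image_id.
Qed.
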